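(* Let $\mathbb{F}$ be a field with $|\mathbb{F}|\geq 4$. Every matrix in $SL_2(\mathbb{F})$ is a product of at most three commutators of $\mathcal{U}_2$-matrices. In particular, if $\operatorname{char}(\mathbb{F})=2$, then every matrix in $SL_2(\mathbb{F})$ is a product of at most two commutators of $\mathcal{U}_2$-matrices; if $\operatorname{char}(\mathbb{F})\neq 2$, then every matrix in $SL_2(\mathbb{F})$ is a product of at most two commutators of $\mathcal{U}_2$-matrices if and only if $-1=a^2+b^2$ for some nonzero $a,b\in\mathbb{F}$.
   Context: $SL_2(\mathbb{F})$ is the group of $2\times 2$ matrices over $\mathbb F$ with determinant $1$. A matrix $X\in M_2(\mathbb{F})$ is a $\mathcal{U}_2$-matrix (unipotent matrix of index $2$) if $(X-I_2)^2=0_2$ and $X\neq I_2$. For invertible $X,Y$, $[X,Y]:=XYX^{-1}Y^{-1}$. A commutator of $\mathcal{U}_2$-matrices is a matrix of the form $[X,Y]$ where both $X,Y\in M_2(\mathbb{F})$ are $\mathcal{U}_2$-matrices. *)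

(* Defs.v *)
From mathcomp Require Import all_boot all_order all_algebra.

Set Implicit Arguments.
Unset Strict Implicit.
Unset Printing Implicit Defensive.

Import GRing.Theory.
Local Open Scope ring_scope.

(* [F] need not be finite, so [#|F|] is not available. *)
Definition has_at_least (n : nat) (T : Type) : Prop :=
  exists f : 'I_n -> T, injective f.

Definition SL2 (F : fieldType) (A : 'M[F]_2) : Prop := \det A = 1.

Definition is_U2 (F : fieldType) (X : 'M[F]_2) : Prop :=
  (X - 1%:M) *m (X - 1%:M) = 0 /\ X <> 1%:M.

(* This is X Y X^-1 Y^-1, unlike the [[~ X, Y]] of fingroup, which is
   X^-1 Y^-1 X Y. *)
Definition mxcommutator (F : fieldType) (X Y : 'M[F]_2) : 'M[F]_2 :=
  X *m Y *m invmx X *m invmx Y.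

Definition is_U2_commutator (F : fieldType) (C : 'M[F]_2) : Prop :=
  exists X Y : 'M[F]_2, [/\ is_U2 X, is_U2 Y & C = mxcommutator X Y].

(* The empty product is allowed; it is the identity, which is also the
   commutator of any U2-matrix with itself. *)
Definition prod_at_most_U2_commutators (F : fieldType) (k : nat)
    (A : 'M[F]_2) : Prop :=
  exists s : seq 'M[F]_2,
    [/\ (size s <= k)%N,
        forall C, C \in s -> is_U2_commutator C
      & A = \big[mulmx/1%:M]_(C <- s) C].

(* Main.v *)
(** A non-scalar matrix of determinant [1] is determined up to similarity by
    its trace, and the top left entry of a similar matrix can be prescribed.
    If [t] is the trace of [(X - 1) (Y - 1)] for U2-matrices [X] and [Y], then
    [X Y X^-1 Y^-1] has trace [2 + t ^ 2], and it is [1] when [t = 0].  Hence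
    the commutators of U2-matrices are [1] and the non-scalar matrices of
    determinant [1] and trace [2 + t ^ 2] with [t != 0].

    Since [F] has at least four elements, some nonzero [m] has [m ^ 2 != 1].
    Matrices with eigenvalues [m ^ 2], [m ^ -2] have trace
    [2 + (m - m ^ -1) ^ 2], and every non-scalar matrix of determinant [1] is
    similar to a product of a lower and an upper triangular matrix with these
    eigenvalues; so it is a product of two commutators.  The only scalar
    matrix left is [-1]: it is a product of two commutators of traces
    [2 + s ^ 2] and [2 + t ^ 2] exactly when [s ^ 2 + t ^ 2 = - 4], and of
    three because [- C^-1] is not scalar when [C] is not. *)

Require Import Defs.
From mathcomp Require Import all_boot all_order all_algebra.
From mathcomp Require Import ring.

Import GRing.Theory.
Local Open Scope ring_scope.

(** * Entrywise calculus for two-by-two matrices *)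

Definition mx2 {R : Type} (a b c d : R) : 'M[R]_2 :=
  \matrix_(i, j) if i == 0 then if j == 0 then a else b
                 else if j == 0 then c else d.

Lemma mx2_eta {R : Type} (A : 'M[R]_2) :
  A = mx2 (A 0 0) (A 0 1) (A 1 0) (A 1 1).
Proof.
apply/matrixP => i j; rewrite mxE.
case: i => [[|[|//]] i2]; case: j => [[|[|//]] j2] /=;
  by congr (A _ _); apply/val_inj.
Qed.

Lemma mx2_inj {R : Type} {a b c d a' b' c' d' : R} :
  mx2 a b c d = mx2 a' b' c' d' -> [/\ a = a', b = b', c = c' & d = d'].
Proof.
move/matrixP => e.
by move: (e 0 0) (e 0 1) (e 1 0) (e 1 1); rewrite !mxE /=; split.
Qed.

Section TwoByTwo.
Variable F : fieldType.
Implicit Types (a b c d m t : F) (A B C P X Y : 'M[F]_2).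

Lemma mul_mx2 a b c d a' b' c' d' :
  mx2 a b c d *m mx2 a' b' c' d' =
  mx2 (a * a' + b * c') (a * b' + b * d') (c * a' + d * c') (c * b' + d * d').
Proof.
by rewrite [LHS]mx2_eta !mxE !big_ord_recl !big_ord0 !mxE /= !addr0.
Qed.

Lemma add_mx2 a b c d a' b' c' d' :
  mx2 a b c d + mx2 a' b' c' d' = mx2 (a + a') (b + b') (c + c') (d + d').
Proof. by rewrite [LHS]mx2_eta !mxE. Qed.

Lemma opp_mx2 a b c d : - mx2 a b c d = mx2 (- a) (- b) (- c) (- d).
Proof. by rewrite [LHS]mx2_eta !mxE. Qed.

Lemma scalar_mx2 a : a%:M = mx2 a 0 0 a.
Proof. by rewrite [LHS]mx2_eta !mxE. Qed.

Lemma det_mx2 a b c d : \det (mx2 a b c d) = a * d - b * c.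
Proof.
rewrite (expand_det_row _ 0) !big_ord_recl big_ord0 addr0 /cofactor !det_mx11.
by rewrite !mxE /= expr0 expr1 mul1r mulN1r mulrN.
Qed.

Lemma tr_mx2 a b c d : \tr (mx2 a b c d) = a + d.
Proof. by rewrite /mxtrace !big_ord_recl big_ord0 !mxE /= addr0. Qed.

Lemma is_scalar_mx2 a b c d :
  is_scalar_mx (mx2 a b c d) = [&& b == 0, c == 0 & a == d].
Proof.
apply/is_scalar_mxP/and3P => [[k] | [/eqP-> /eqP-> /eqP->]].
  by rewrite scalar_mx2 => /mx2_inj[-> -> -> ->]; rewrite !eqxx.
by exists d; rewrite scalar_mx2.
Qed.

Lemma inv_mx2 a b c d :
  a * d - b * c = 1 -> invmx (mx2 a b c d) = mx2 d (- b) (- c) a.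
Proof.
move=> det1.
have uA : mx2 a b c d \in unitmx by rewrite unitmxE det_mx2 det1 unitr1.
apply: (can_inj (mulKmx uA)); rewrite mulmxV // mul_mx2 scalar_mx2.
by congr mx2; rewrite -?det1; ring.
Qed.

(** * Determinant-one matrices up to similarity *)

Lemma scalar_SL2 A : SL2 A -> is_scalar_mx A -> A = 1%:M \/ A = - 1%:M.
Proof.
rewrite [A]mx2_eta; move: (A 0 0) (A 0 1) (A 1 0) (A 1 1) => p q r s.
rewrite /SL2 is_scalar_mx2 det_mx2 !scalar_mx2 opp_mx2 oppr0 => det1.
case/and3P => /eqP q0 /eqP r0 /eqP ps; move: det1.
rewrite q0 r0 ps mul0r subr0 => /eqP; rewrite -expr2 sqrf_eq1.
by case/orP => /eqP->; [left | right].
Qed.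

(** In a basis [v], [A v - a v] the first column of [A] becomes [(a, 1)]; trace and determinant then
    force the second column. *)
Lemma nonscalar_similar A a : SL2 A -> ~~ is_scalar_mx A ->
  exists2 P, P \in unitmx &
    A = P *m mx2 a (a * (\tr A - a) - 1) 1 (\tr A - a) *m invmx P.
Proof.
rewrite [A]mx2_eta; move: (A 0 0) (A 0 1) (A 1 0) (A 1 1) => p q r s.
rewrite /SL2 is_scalar_mx2 det_mx2 tr_mx2 => det1 nscal.
pose good P := \det P != 0 /\ mx2 p q r s *m P =
  P *m mx2 a (a * (p + s - a) - (p * s - q * r)) 1 (p + s - a).
suff [P [detP AP]] : exists P, good P.
  have uP : P \in unitmx by rewrite unitmxE unitfE.
  by exists P => //; rewrite det1 in AP; rewrite -AP mulmxK.
(* The columns of [P] are [v] and [A v - a v] for a non-eigenvector [v]. *)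
have [r0|r0] := eqVneq r 0; last first.
  exists (mx2 1 (p - a) 0 r); rewrite /good det_mx2 !mul_mx2.
  by split; [rewrite mul1r mulr0 subr0 | congr mx2; ring].
have [q0|q0] := eqVneq q 0; last first.
  exists (mx2 0 q 1 (s - a)); rewrite /good det_mx2 !mul_mx2.
  by split; [rewrite mul0r mulr1 sub0r oppr_eq0 | congr mx2; ring].
(* [A] is now diagonal with [p != s], so [(1, 1)] is not an eigenvector. *)
exists (mx2 1 (p - a) 1 (s - a)); rewrite /good det_mx2 !mul_mx2 q0 r0.
split; last by congr mx2; ring.
have -> : 1 * (s - a) - (p - a) * 1 = s - p by ring.
by rewrite subr_eq0 eq_sym; move: nscal; rewrite q0 r0 !eqxx.
Qed.

(** * Invariance under conjugation *)

Lemma conj_mulmx P A B : P \in unitmx ->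
  P *m (A *m B) *m invmx P = (P *m A *m invmx P) *m (P *m B *m invmx P).
Proof. by move=> uP; rewrite !mulmxA mulmxKV. Qed.

Lemma conj_invmx P A : P \in unitmx ->
  invmx (P *m A *m invmx P) = P *m invmx A *m invmx P.
Proof.
move=> uP; have [uA|nuA] := boolP (A \in unitmx); last first.
  (* [invmx] fixes non-invertible matrices, so both sides are the conjugate of [A]. *)
  rewrite (invmx_out nuA) invmx_out //.
  by rewrite inE !unitmx_mul unitmx_inv uP (negPf nuA).
have uPA : P *m A *m invmx P \in unitmx.
  by rewrite !unitmx_mul unitmx_inv uP uA.
apply: (can_inj (mulKmx uPA)).
by rewrite -conj_mulmx // !mulmxV // mulmx1 mulmxV.
Qed.

Lemma conj_is_U2 P X : P \in unitmx -> is_U2 X -> is_U2 (P *m X *m invmx P).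
Proof.
move=> uP [X2 X1]; have eP1 : 1%:M = P *m 1%:M *m invmx P.
  by rewrite mulmx1 mulmxV.
split=> [|eP].
  rewrite eP1 -mulmxBl -mulmxBr -conj_mulmx //.
  by rewrite X2 mulmx0 mul0mx.
apply: X1; rewrite -[X](mulKmx uP) -[P *m X](mulmxKV uP) eP.
by rewrite mul1mx mulVmx.
Qed.

Lemma conj_is_U2_commutator P C : P \in unitmx ->
  is_U2_commutator C -> is_U2_commutator (P *m C *m invmx P).
Proof.
move=> uP [X [Y [U2X U2Y ->]]].
exists (P *m X *m invmx P), (P *m Y *m invmx P).
split; [exact: conj_is_U2 | exact: conj_is_U2 |].
by rewrite /mxcommutator !conj_invmx // !(conj_mulmx P).
Qed.

(** * Trace criterion for commutators of U2-matrices *)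

Lemma is_U2P X : is_U2 X ->
  exists a b c, X = mx2 (1 + a) b c (1 - a) /\ a ^+ 2 + b * c = 0.
Proof.
case; rewrite [X]mx2_eta; move: (X 0 0) (X 0 1) (X 1 0) (X 1 1) => p q r s.
have -> : 0 = mx2 0 0 0 0 :> 'M[F]_2 by rewrite [LHS]mx2_eta !mxE.
rewrite scalar_mx2 opp_mx2 add_mx2 mul_mx2.
rewrite !oppr0 !addr0 => /mx2_inj[e00 e01 e10 e11] _.
(* [X - 1] has trace zero: the off-diagonal entry of its square is [q] times its trace, and [q = 0]
   forces a zero diagonal. *)
have tr2 : s = 1 - (p - 1).
  have [//|] := eqVneq s (1 - (p - 1)); rewrite -subr_eq0 => ne.
  have q0 : q = 0 by apply: (mulIf ne); rewrite mul0r -[RHS]e01; ring.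
  move: e00 e11; rewrite q0 mul0r mulr0 addr0 add0r.
  move=> /eqP; rewrite mulf_eq0 orbb subr_eq0 => /eqP p1.
  move=> /eqP; rewrite mulf_eq0 orbb subr_eq0 => /eqP ->.
  by rewrite p1; ring.
exists (p - 1), q, r; split; last by rewrite expr2.
by rewrite tr2; congr mx2; ring.
Qed.

Lemma U2_commutator_trace C : is_U2_commutator C ->
  SL2 C /\ (C = 1%:M \/ exists2 t, t != 0 & \tr C = 2%:R + t ^+ 2).
Proof.
case=> X [Y [/is_U2P[a [b [c [-> hX]]]] /is_U2P[d [e [f [-> hY]]]] ->]].
have invU (x y z : F) : x ^+ 2 + y * z = 0 ->
  invmx (mx2 (1 + x) y z (1 - x)) = mx2 (1 - x) (- y) (- z) (1 + x).
  by move=> h; apply: inv_mx2; rewrite -[RHS]subr0 -h; ring.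
have bc : b * c = - a ^+ 2 by apply/eqP; rewrite -addr_eq0 addrC hX.
have ef : e * f = - d ^+ 2 by apply/eqP; rewrite -addr_eq0 addrC hY.
have dX : (1 + a) * (1 - a) - b * c = 1 by ring: bc.
have dY : (1 + d) * (1 - d) - e * f = 1 by ring: ef.
have uX : mx2 (1 + a) b c (1 - a) \in unitmx.
  by rewrite unitmxE det_mx2 dX unitr1.
have uY : mx2 (1 + d) e f (1 - d) \in unitmx.
  by rewrite unitmxE det_mx2 dY unitr1.
split.
  rewrite /SL2 /mxcommutator !det_mulmx !det_inv !det_mx2 dX dY.
  by rewrite invr1 !mulr1.
set t := 2%:R * a * d + b * f + c * e.
have [t0|t0] := eqVneq t 0; [left | right; exists t => //].
- have sq0 (x : F) : x ^+ 2 = 0 -> x = 0.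
    by move/eqP; rewrite expf_eq0 => /andP[_ /eqP].
  (* The squares of the minors of [(a, b, c)] and [(d, e, f)] are multiples of [t]. When [t = 0]
     they vanish, and this makes [X] and [Y] commute. *)
  have h1 : a * e = b * d.
    apply/eqP; rewrite -subr_eq0; apply/eqP/sq0.
    by transitivity (- (b * e) * t); [rewrite /t; ring: bc ef
      | rewrite t0 mulr0].
  have h2 : a * f = c * d.
    apply/eqP; rewrite -subr_eq0; apply/eqP/sq0.
    by transitivity (- (c * f) * t); [rewrite /t; ring: bc ef
      | rewrite t0 mulr0].
  have h3 : b * f = c * e.
    apply/eqP; rewrite -subr_eq0; apply/eqP/sq0.
    transitivity (t * (b * f + c * e - 2%:R * a * d)); last by rewrite t0 mul0r.
    by rewrite /t; ring: bc ef.
  have comm : mx2 (1 + a) b c (1 - a) *m mx2 (1 + d) e f (1 - d) =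
              mx2 (1 + d) e f (1 - d) *m mx2 (1 + a) b c (1 - a).
    by rewrite !mul_mx2; congr mx2; [ring: h3|ring: h1|ring: h2|ring: h3].
  by rewrite /mxcommutator comm mulmxK // mulmxV.
by rewrite /mxcommutator !invU // !mul_mx2 tr_mx2 /t; ring: bc ef.
Qed.

Lemma is_U2_commutator_of_trace C t : SL2 C -> ~~ is_scalar_mx C ->
  t != 0 -> \tr C = 2%:R + t ^+ 2 -> is_U2_commutator C.
Proof.
move=> detC nsC t0 trC.
(* A model pair with [(X - 1) (Y - 1)] of trace [t]. Its commutator [K] and [C] share the normal
   form with top left entry 0. *)
pose X : 'M[F]_2 := mx2 1 1 0 1; pose Y := mx2 1 0 t 1.
have U2X : is_U2 X.
  split; rewrite /X scalar_mx2.
    by rewrite opp_mx2 add_mx2 mul_mx2 [RHS]mx2_eta !mxE; congr mx2; ring.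
  by case/mx2_inj=> _ /eqP; rewrite oner_eq0.
have U2Y : is_U2 Y.
  split; rewrite /Y scalar_mx2.
    by rewrite opp_mx2 add_mx2 mul_mx2 [RHS]mx2_eta !mxE; congr mx2; ring.
  by case/mx2_inj=> _ _ /eqP; rewrite (negPf t0).
have [K KE] : exists K, K = mxcommutator X Y by eexists.
have K_comm : is_U2_commutator K by exists X, Y.
have KE2 : K = mx2 (1 + t + t ^+ 2) (- t) (t ^+ 2) (1 - t).
  rewrite KE /mxcommutator !inv_mx2 ?mul_mx2; try ring.
  by congr mx2; ring.
have detK : SL2 K by rewrite /SL2 KE2 det_mx2; ring.
have nsK : ~~ is_scalar_mx K.
  by rewrite KE2 is_scalar_mx2 oppr_eq0 (negPf t0).
have trK : \tr K = \tr C by rewrite KE2 tr_mx2 trC; ring.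
have [P uP ->] := nonscalar_similar C 0 detC nsC.
have [Q uQ KQ] := nonscalar_similar K 0 detK nsK.
apply: conj_is_U2_commutator => //; rewrite -trK.
set M := mx2 _ _ _ _ in KQ *.
have -> : M = invmx Q *m K *m invmx (invmx Q).
  by rewrite KQ invmxK mulmxA mulmxKV // mulKmx.
by apply: conj_is_U2_commutator => //; rewrite unitmx_inv.
Qed.

(** * Non-scalar matrices as products of two commutators *)

Lemma nonscalar_prod2 m A : m != 0 -> m ^+ 2 != 1 ->
  SL2 A -> ~~ is_scalar_mx A ->
  exists C D, [/\ is_U2_commutator C, is_U2_commutator D & A = C *m D].
Proof.
move=> m0 m1 detA nsA.
(* The entry [m ^+ 4] is the product of the top left entries [m ^+ 2] of the two triangular
   factors. *)
have [P uP ->] := nonscalar_similar A (m ^+ 4) detA nsA.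
suff [C [D [hC hD ->]]] : exists C D : 'M[F]_2, [/\ is_U2_commutator C,
    is_U2_commutator D &
    mx2 (m ^+ 4) (m ^+ 4 * (\tr A - m ^+ 4) - 1) 1 (\tr A - m ^+ 4) = C *m D].
  exists (P *m C *m invmx P), (P *m D *m invmx P).
  by rewrite conj_mulmx //; split=> //; apply: conj_is_U2_commutator.
move: (\tr A - m ^+ 4) => d.
have t0 : m - m^-1 != 0.
  apply: contraNneq m1 => /subr0_eq mV.
  by rewrite expr2 {1}mV mulVf.
(* The exceptional case is the one where the upper triangular factor [U] below would be scalar.
   There the matrix is unipotent and is the square of [C], of trace [-2 = 2 + (2 m) ^ 2] because
   [m ^ 2 = -1]. *)
have [/andP[/eqP b0 /eqP m4]|gen] :=
  boolP ((m ^+ 4 * d - 1 == 0) && (m ^+ 4 == 1)).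
- have m2 : m ^+ 2 = -1.
    have: (m ^+ 2) ^+ 2 == 1 by rewrite -exprM m4.
    by rewrite sqrf_eq1 (negPf m1) => /eqP.
  have two0 : 2%:R != 0 :> F.
    apply: contraNneq m1 => two0; rewrite m2 eq_sym -subr_eq0 opprK.
    by rewrite -two0 -natr1.
  have d1 : d = 1 by move: b0; rewrite m4 mul1r => /subr0_eq.
  pose C := mx2 (-1) 0 (- 2%:R^-1) (-1) : 'M[F]_2.
  have C_comm : is_U2_commutator C.
    apply: (@is_U2_commutator_of_trace _ (2%:R * m)).
    - by rewrite /SL2 /C det_mx2; ring.
    - by rewrite /C is_scalar_mx2 oppr_eq0 invr_eq0 (negPf two0) andbF.
    - by rewrite mulf_neq0.
    - by rewrite /C tr_mx2; ring: m2.
  exists C, C; split=> //; rewrite /C mul_mx2 b0 m4 d1.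
  by congr mx2; field.
pose L := mx2 (m ^+ 2) 0 (m ^- 2) (m ^- 2).
pose U := mx2 (m ^+ 2) (m ^- 2 * (m ^+ 4 * d - 1)) 0 (m ^- 2).
have mE : m ^+ 2 * m ^- 2 = 1 by rewrite mulfV // expf_neq0.
exists L, U; split.
- apply: (@is_U2_commutator_of_trace _ (m - m^-1)) => //.
  + by rewrite /SL2 det_mx2 mul0r subr0.
  + by rewrite is_scalar_mx2 invr_eq0 expf_eq0 (negPf m0) /= andbF.
  + by rewrite tr_mx2; field.
- apply: (@is_U2_commutator_of_trace _ (m - m^-1)) => //.
  + by rewrite /SL2 det_mx2 mulr0 subr0.
  + rewrite is_scalar_mx2 eqxx mulf_eq0 invr_eq0 expf_eq0 (negPf m0) /=.
    apply: contra gen => /andP[-> /eqP m2V] /=.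
    by rewrite (exprM m 2 2) expr2 {2}m2V mE.
  + by rewrite tr_mx2; field.
- by rewrite /L /U mul_mx2; congr mx2; field.
Qed.

(** * The matrix [-1] as a product of commutators *)

Lemma is_U2_commutator_companion t : t != 0 ->
  is_U2_commutator (mx2 0 (-1) 1 (2%:R + t ^+ 2)).
Proof.
move=> t0; apply: (@is_U2_commutator_of_trace _ t) => //.
- by rewrite /SL2 det_mx2; ring.
- by rewrite is_scalar_mx2 oppr_eq0 oner_eq0.
- by rewrite tr_mx2 add0r.
Qed.

(** The second factor is the negated inverse of the first, so its trace is [- t]. *)
Lemma opp1_prod_companion t :
  - 1%:M = mx2 0 (-1) 1 t *m mx2 (- t) (-1) 1 0 :> 'M[F]_2.
Proof. by rewrite mul_mx2 scalar_mx2 opp_mx2; congr mx2; ring. Qed.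

Lemma opp1_prod2 a b : 2%:R != 0 :> F -> a != 0 -> b != 0 ->
  -1 = a ^+ 2 + b ^+ 2 ->
  exists C D, [/\ is_U2_commutator C, is_U2_commutator D & - 1%:M = C *m D].
Proof.
move=> two0 a0 b0 ab.
(* The second trace is [-2 - 4 a ^ 2], which equals [2 + (2 b) ^ 2]. *)
exists (mx2 0 (-1) 1 (2%:R + (2%:R * a) ^+ 2)).
exists (mx2 (- (2%:R + (2%:R * a) ^+ 2)) (-1) 1 0).
split; [| | exact: opp1_prod_companion].
  by apply: is_U2_commutator_companion; rewrite mulf_neq0.
apply: (@is_U2_commutator_of_trace _ (2%:R * b)); rewrite ?mulf_neq0 //.
- by rewrite /SL2 det_mx2; ring.
- by rewrite is_scalar_mx2 oppr_eq0 oner_eq0.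
- have b2 : b ^+ 2 = -1 - a ^+ 2 by rewrite ab; ring.
  by rewrite tr_mx2; ring: b2.
Qed.

Lemma opp1_prod3 m : m != 0 -> m ^+ 2 != 1 ->
  exists B C D, [/\ is_U2_commutator B, is_U2_commutator C,
    is_U2_commutator D & - 1%:M = B *m (C *m D)].
Proof.
move=> m0 m1.
have [C [D [hC hD CD]]] : exists C D, [/\ is_U2_commutator C,
    is_U2_commutator D & mx2 (- (2%:R + m ^+ 2)) (-1) 1 0 = C *m D].
  apply: (nonscalar_prod2 m) => //; first by rewrite /SL2 det_mx2; ring.
  by rewrite is_scalar_mx2 oppr_eq0 oner_eq0.
exists (mx2 0 (-1) 1 (2%:R + m ^+ 2)), C, D.
by split=> //; [exact: is_U2_commutator_companion
  | rewrite -CD -opp1_prod_companion].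
Qed.

(** Here [X Y X^-1 = - Y], and [Y] has trace 2; comparing traces gives [4 = 0]. *)
Lemma is_U2_commutator_opp1 :
  is_U2_commutator (- 1%:M : 'M[F]_2) -> 2%:R = 0 :> F.
Proof.
case=> X [Y [/is_U2P[a [b [c [XE hX]]]] /is_U2P[d [e [f [YE hY]]]] XY]].
have uX : X \in unitmx.
  suff -> : X \in unitmx = (1 - (a ^+ 2 + b * c) \is a GRing.unit).
    by rewrite hX subr0 unitr1.
  by rewrite XE unitmxE det_mx2; congr (_ \is a _); ring.
have uY : Y \in unitmx.
  suff -> : Y \in unitmx = (1 - (d ^+ 2 + e * f) \is a GRing.unit).
    by rewrite hY subr0 unitr1.
  by rewrite YE unitmxE det_mx2; congr (_ \is a _); ring.
have trY : \tr Y = 2%:R by rewrite YE tr_mx2; ring.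
have : - Y = X *m Y *m invmx X.
  by rewrite -[RHS](mulmxKV uY) -/(mxcommutator X Y) -XY mulNmx mul1mx.
move/(congr1 mxtrace); rewrite -mulmxA mxtrace_mulC mulmxKV // raddfN /= trY.
move/eqP; rewrite eq_sym -addr_eq0 -natrD (natrM _ 2 2) mulf_eq0 orbb.
by move/eqP.
Qed.

Lemma tr_inv_SL2 A : SL2 A -> \tr (invmx A) = \tr A.
Proof.
rewrite [A]mx2_eta /SL2 det_mx2 => detA.
by rewrite inv_mx2 // !tr_mx2 addrC.
Qed.

(** Neither factor is 1, since the other would be [-1]. As [D = - C^-1], the traces give
    [2 + t ^ 2 = - (2 + s ^ 2)]; dividing [s] and [t] by 2 gives the pair. *)
Lemma opp1_prod2_inv C D : 2%:R != 0 :> F ->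
  is_U2_commutator C -> is_U2_commutator D -> - 1%:M = C *m D ->
  exists a b : F, [/\ a != 0, b != 0 & -1 = a ^+ 2 + b ^+ 2].
Proof.
move=> two0 hC hD CD.
have [detC [C1|[s s0 trC]]] := U2_commutator_trace _ hC.
  move: hD; rewrite -[D]mul1mx -C1 -CD => /is_U2_commutator_opp1 /eqP.
  by rewrite (negPf two0).
have [_ [D1|[t t0 trD]]] := U2_commutator_trace _ hD.
  move: hC; rewrite -[C]mulmx1 -D1 -CD => /is_U2_commutator_opp1 /eqP.
  by rewrite (negPf two0).
have uC : C \in unitmx by rewrite unitmxE detC unitr1.
have DE : D = - invmx C.
  by rewrite -[LHS](mulKmx uC) -CD mulmxN mulmx1.
exists (s / 2%:R), (t / 2%:R); split; rewrite ?mulf_neq0 ?invr_eq0 //.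
have t2 : t ^+ 2 = - (2%:R + s ^+ 2) - 2%:R.
  move/(congr1 mxtrace): DE; rewrite raddfN /= tr_inv_SL2 // trC trD => <-.
  by ring.
rewrite !expr_div_n t2; field.
by rewrite (natrM _ 2 2) mulf_neq0.
Qed.

(** Only 0, 1 and -1 can fail, and four distinct elements do not fit among them. *)
Lemma exists_sqr_neq1 : has_at_least 4 F -> exists2 m : F, m != 0 & m ^+ 2 != 1.
Proof.
case=> f f_inj.
have /hasP[m _] : has (fun m => (m != 0) && (m ^+ 2 != 1)) (codom f).
  apply: contraTT isT => /hasPn no_m.
  have : (size (codom f) <= size ([:: 0; 1; -1] : seq F)%R)%N.
    apply: uniq_leq_size => [|x /no_m]; first exact/injectiveP.
    by rewrite negb_and !negbK sqrf_eq1 !inE.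
  by rewrite size_codom card_ord.
by case/andP; exists m.
Qed.

End TwoByTwo.

(** * Assembly of the three claims *)

Theorem theorem3p14 (F : fieldType) (hF : has_at_least 4 F) :
  [/\ forall A : 'M[F]_2, SL2 A -> prod_at_most_U2_commutators 3 A,
      2%N \in [pchar F] ->
        forall A : 'M[F]_2, SL2 A -> prod_at_most_U2_commutators 2 A
    & 2%N \notin [pchar F] ->
        ((forall A : 'M[F]_2, SL2 A -> prod_at_most_U2_commutators 2 A) <->
         (exists a b : F, [/\ a != 0, b != 0 & -1 = a ^+ 2 + b ^+ 2]))].
Proof.
have [m m0 m1] := exists_sqr_neq1 F hF.
have prod1 k : prod_at_most_U2_commutators k (1%:M : 'M[F]_2).
  by exists [::]; split=> //; rewrite big_nil.
have prod2 k (A C D : 'M[F]_2) : is_U2_commutator C -> is_U2_commutator D ->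
    A = C *m D -> prod_at_most_U2_commutators k.+2 A.
  move=> hC hD ->; exists [:: C; D]; split=> // [B|].
    by rewrite !inE => /orP[]/eqP->.
  by rewrite !big_cons big_nil mulmx1.
(* Each claim reduces to the scalar matrices 1 and -1; the former is the empty product. *)
have prod_nonscalar k (A : 'M[F]_2) :
    (is_scalar_mx A -> prod_at_most_U2_commutators k.+2 A) ->
    SL2 A -> prod_at_most_U2_commutators k.+2 A.
  move=> scal detA; have [/scal //|nsA] := boolP (is_scalar_mx A).
  have [C [D [hC hD AE]]] := nonscalar_prod2 _ m _ m0 m1 detA nsA.
  exact: prod2 hC hD AE.
split.
- move=> A detA; apply: prod_nonscalar => // /(scalar_SL2 _ _ detA)[->|->] //.
  have [B [C [D [hB hC hD BCD]]]] := opp1_prod3 _ m m0 m1.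
  exists [:: B; C; D]; split=> // [E|].
    by rewrite !inE => /or3P[]/eqP->.
  by rewrite !big_cons big_nil mulmx1.
- move=> char2 A detA; apply: prod_nonscalar => //.
  case/(scalar_SL2 _ _ detA) => -> //.
  suff -> : - 1%:M = 1%:M :> 'M[F]_2 by [].
  by rewrite -raddfN oppr_pchar2.
- move=> nchar2; have two0 : 2%:R != 0 :> F by rewrite inE /= in nchar2.
  split=> [/(_ (- 1%:M)) | [a [b [a0 b0 ab]]] A detA].
    case=> [|s [+ + sE]]; first by rewrite /SL2 scalar_mx2 opp_mx2 det_mx2; ring.
    (* No factor would give [-1 = 1], and one factor would make [-1] a commutator; both contradict
       [two0]. *)
    case: s sE => [|C [|D [|//]]]; rewrite ?big_cons big_nil ?mulmx1 => sE _ hs.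
    + move: sE; rewrite scalar_mx2 opp_mx2 => /mx2_inj[/eqP + _ _ _].
      by rewrite eq_sym -addr_eq0 (negPf two0).
    + have := hs C (mem_head _ _); rewrite -sE => /is_U2_commutator_opp1/eqP.
      by rewrite (negPf two0).
    + by apply: (opp1_prod2_inv _ C D) => //; apply: hs; rewrite !inE eqxx ?orbT.
  apply: prod_nonscalar => // /(scalar_SL2 _ _ detA)[->|->] //.
  have [C [D [hC hD CD]]] := opp1_prod2 _ _ _ two0 a0 b0 ab.
  exact: prod2 hC hD CD.
Qed.
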